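(* Let $X$ be a real Banach space of dimension greater than one and let $T:X\rightrightarrows X^*$ be a (non-empty) monotone operator whose domain $D(T)$ is not a singleton and such that ${}^{ic}D(T)\neq\emptyset$. Then $T$ is maximal monotone if and only if all of the following hold: (i) $T+N_L$ is maximal monotone for every line $L\subset\operatorname{aff}D(T)$ such that $L\cap{}^{ic}D(T)\neq\emptyset$; (ii) for every $x\in D(T)$ the set $T(x)$ is weak-star closed and convex; (iii) $T=T+N_{D(T)}$.
   Context: $X^*$ is the topological dual of $X$ and $\langle x,x^*\rangle:=x^*(x)$. A multifunction $T:X\rightrightarrows X^*$ is identified with its graph $\{(x,x^* )\mid x^*\in T(x)\}$; its domain is $D(T)=\{x\mid T(x)\neq\emptyset\}$. $T$ is monotone if $\langle x_1-x_2,x_1^*-x_2^*\rangle\ge0$ for all $(x_1,x_1^* ),(x_2,x_2^* )\in T$; it is maximal monotone if it is monotone and its graph is not properly contained in the graph of another monotone operator $X\rightrightarrows X^*$. Sums of operators are pointwise: $(S+T)(x)=S(x)+T(x)$ (empty if one of the two is empty). For $C\subset X$ (not necessarily convex), $N_C(x)=\{x^*\in X^*\mid\langle y-x,x^*\rangle\le0\ \forall y\in C\}$ if $x\in C$, and $N_C(x)=\emptyset$ otherwise. $\operatorname{aff}S$ is the affine hull of $S$. For $S\subset X$, the relative algebraic interior ${}^{i}S$ is the set of $s\in S$ such that for every $u\in\operatorname{aff}S$ there is $\rho>0$ with $(1-\lambda)s+\lambda u\in S$ for all $\lambda\in[0,\rho]$; ${}^{ic}S:={}^{i}S$ if $\operatorname{aff}S$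 is norm closed, and ${}^{ic}S:=\emptyset$ otherwise. A line is a one-dimensional affine subset. *)

(* Defs.v *)
From HB Require Import structures.
From mathcomp Require Import all_boot all_order all_algebra.
From mathcomp Require Import all_classical all_reals all_analysis.

Set Implicit Arguments.
Unset Strict Implicit.
Unset Printing Implicit Defensive.

Import Order.TTheory GRing.Theory Num.Theory.
Import numFieldNormedType.Exports.

Local Open Scope classical_set_scope.
Local Open Scope ring_scope.

Section Dual.
Context {R : realType} {X : normedModType R}.

Definition linear_continuous_pred : {pred X -> R^o} :=
  fun f => `[< linear f /\ continuous f >].

Lemma linear_continuous_submod_closed : submod_closed linear_continuous_pred.
Proof.
split => [|a f g /asboolP[lf cf] /asboolP[lg cg]]; apply/asboolP; split.
- by move=> a u v; rewrite /= scaler0 addr0.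
- by move=> x; exact: cvg_cst.
- move=> b u v; rewrite /= !fctE lf lg !scalerDr !scalerA (mulrC a b).
  by rewrite addrACA.
- by move=> x; apply: cvgD; [apply: cvgZr; exact: cf|exact: cg].
Qed.

HB.instance Definition _ := GRing.isSubmodClosed.Build R (X -> R^o)
  linear_continuous_pred linear_continuous_submod_closed.

Record dual : Type := Dual {
  dual_fun :> X -> R^o;
  _ : dual_fun \in linear_continuous_pred }.

HB.instance Definition _ := [isSub for dual_fun].
HB.instance Definition _ := [Choice of dual by <:].
HB.instance Definition _ := [SubChoice_isSubLmodule of dual by <:].

(* The product topology on X -> R is the coarsest one making every evaluation
   continuous; the weak-star topology is the one it induces on the dual. *)
Definition weak_star : topologicalType :=
  @initial_topology dual {ptws X -> R} dual_fun.

Definition weak_star_closed (A : set dual) := @closed weak_star A.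

End Dual.
Arguments dual {R} X.
Arguments weak_star {R} X.

Section Affine.
Context {R : realType} {X : normedModType R}.
Implicit Types S A L : set X.

Definition affine_set A :=
  forall x y, A x -> A y -> forall t : R, A ((1 - t) *: x + t *: y).

Definition aff S : set X := smallest affine_set S.

Definition rel_alg_interior S : set X :=
  [set s | S s /\ forall u, aff S u ->
     exists2 rho : R, 0 < rho &
       forall l : R, 0 <= l <= rho -> S ((1 - l) *: s + l *: u)].

Definition ic S : set X :=
  [set s | closed (aff S) /\ rel_alg_interior S s].

Definition is_line L :=
  exists p d : X, d != 0 /\ L = [set p + t *: d | t in [set: R]].

End Affine.

(* X need not be finite-dimensional, so [\dim] is not available. *)
Definition dim_gt1 (R : realType) (X : normedModType R) :=
  exists u v : X, forall a b : R, a *: u + b *: v = 0 -> a = 0 /\ b = 0.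

Section Operators.
Context {R : realType} {X : normedModType R}.

Definition operator := X -> set (dual X).

Implicit Types S T : operator.

Definition graph T : set (X * dual X) := [set p | T p.1 p.2].

Definition dom T : set X := [set x | T x !=set0].

Definition monotone_operator T := forall p q, graph T p -> graph T q ->
  0 <= (p.2 - q.2 : dual X) (p.1 - q.1).

Definition maximal_monotone T :=
  monotone_operator T /\
  ~ exists2 S : operator, monotone_operator S & graph T `<` graph S.

Definition op_add S T : operator :=
  fun x => [set f + g | f in S x & g in T x].

Definition normal_cone (C : set X) : operator :=
  fun x => [set f | C x /\ forall y, C y -> f (y - x) <= 0].

End Operators.
Arguments operator {R} X.

(* Main.v *)
(* Write A = aff D(T) and let V be its direction, a Banach space.

   If T is maximal, a Baire argument gives a ball of A on which T is bounded.
   A Mazur-Orlicz argument on the cone generated by the pairs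
   (y - z, g (y - z)), g in T(y), then shows, first, that D(T) contains the
   relative core of its convex hull, and second, that the restriction of T to a
   line through a core point is maximal as an operator on the real line, which
   is what maximality of T + N_L means.

   Conversely, let (x, f) be monotonically related to T. By (iii), x lies in A,
   and by (i), for every v in ic D(T) some g in T(x) satisfies
   g (x - v) = f (x - v). If f is not in T(x), separate it from T(x) by some u
   in X. By (iii), u is a limit of directions k (v - x) with v in ic D(T). By (i)
   and local boundedness ic D(T) is the relative interior of D(T) and is convex,
   so that the perturbations l (v0 - x) + (1 - l) u are themselves such
   directions, and l -> 0 gives a contradiction. *)
Require Import Defs.
From HB Require Import structures.
From mathcomp Require Import all_boot all_order all_algebra.
From mathcomp Require Import all_classical all_reals all_analysis.
From mathcomp Require Import ring lra.
Set Implicit Arguments.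
Unset Strict Implicit.
Unset Printing Implicit Defensive.
Import Order.TTheory GRing.Theory Num.Theory.
Import numFieldNormedType.Exports.
Local Open Scope classical_set_scope.
Local Open Scope ring_scope.

(** * Hahn-Banach and Mazur-Orlicz *)

Section HahnBanach.
Context {R : realType} {E : lmodType R}.
Implicit Types (p q : E -> R) (K : E -> R -> Prop).

Definition sublinear p :=
  (forall x y, p (x + y) <= p x + p y) /\
  (forall a x, 0 <= a -> p (a *: x) <= a * p x).

(** A convex cone in [E * R]; a pair [K x a] is read as the constraint [f x <= a] on a functional to
    be found. *)
Definition cone_rel K :=
  [/\ K 0 0,
      forall x y a b, K x a -> K y b -> K (x + y) (a + b) &
      forall t x a, 0 <= t -> K x a -> K (t *: x) (t * a)].

Lemma sublinear0 p : sublinear p -> p 0 = 0.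
Proof.
move=> [pD pZ]; have := pD 0 0; have := pZ 0 0 (lexx 0).
rewrite scale0r addr0 mul0r; lra.
Qed.

Lemma sublinearZ p a x : sublinear p -> 0 <= a -> p (a *: x) = a * p x.
Proof.
move=> sp; rewrite le_eqVlt => /orP[/eqP <-|a0].
  by rewrite scale0r mul0r sublinear0.
have [_ pZ] := sp; apply/eqP; rewrite eq_le pZ ?(ltW a0)//=.
have /pZ : 0 <= a^-1 by rewrite invr_ge0 ltW.
move=> /(_ (a *: x)); rewrite scalerA mulVf ?gt_eqF// scale1r => le.
by move: le; rewrite ler_pdivlMl.
Qed.

(** [q x] is the infimum of the fibre over [x]. Adding a pair over [- x] lands over 0, whence a
    lower bound. *)
Lemma cone_envelope K : cone_rel K -> (forall x, exists a, K x a) ->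
  (forall a, K 0 a -> 0 <= a) ->
  exists q, [/\ sublinear q, forall x a, K x a -> q x <= a &
    forall x M, (forall a, K x a -> M <= a) -> M <= q x].
Proof.
move=> [K0 KD KZ] Kdom Kpos.
have Klb x : has_inf [set a | K x a].
  split; first exact: Kdom.
  have [b Kb] := Kdom (- x); exists (- b) => a /= Ka.
  by have := KD _ _ _ _ Ka Kb; rewrite subrr => /Kpos; lra.
pose q x := inf [set a | K x a].
have qle x a : K x a -> q x <= a by move=> Ka; apply: ge_inf => //;
  exact: (Klb x).2.
have qge x M : (forall a, K x a -> M <= a) -> M <= q x.
  by move=> h; apply: lb_le_inf; [exact: (Klb x).1|exact: h].
exists q; split=> //; split=> [x y|t x t0].
  rewrite -lerBlDr; apply: (qge) => a Ka; rewrite lerBlDr -lerBlDl.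
  by apply/(qge) => b Kb; rewrite lerBlDl; apply: qle; exact: KD.
move: t0; rewrite le_eqVlt => /orP[/eqP <-|t0].
  by rewrite scale0r mul0r; exact: qle.
rewrite -ler_pdivrMl//; apply: qge => a Ka; rewrite ler_pdivrMl//.
by apply: qle; apply: KZ => //; exact: ltW.
Qed.

Lemma minimal_sublinear p : sublinear p ->
  exists q, [/\ sublinear q, forall x, q x <= p x &
    forall r, sublinear r -> (forall x, r x <= q x) -> forall x, r x = q x].
Proof.
move=> sp; pose T := {q : E -> R | sublinear q /\ forall x, q x <= p x}.
(* The order is reversed, so that Zorn's lemma yields a minimal function. *)
pose le (q r : T) := `[<forall x, sval r x <= sval q x>].
have [|q r s /asboolP qr /asboolP rs|A Atot|[q [sq qp]] qmax] := @ZL_preorder T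
   (exist _ p (conj sp (fun x => lexx _))) le.
- by move=> q; apply/asboolP.
- by apply/asboolP => x; exact: le_trans (rs x) (qr x).
- have [[r0 Ar0]|/forallNP A0] := pselect (exists r, A r); last first.
    by exists (exist _ p (conj sp (fun x => lexx _))) => s /A0.
  (* The infimum of a chain is the envelope of the union of its epigraphs, which is a cone because
     members of a chain are comparable. *)
  have [||a [r Ar]|] := @cone_envelope (fun x a => exists2 r, A r & sval r x <= a).
  + split=> [|x y a b [r Ar ra] [s As sb]|t x a t0 [r Ar ra]].
    * by exists r0 => //; rewrite sublinear0//; exact: (svalP r0).1.
    * have [/asboolP h|/asboolP h] := Atot _ _ Ar As.
      - exists s => //; apply: le_trans ((svalP s).1.1 _ _) _.
        by have := h x; lra.
      - exists r => //; apply: le_trans ((svalP r).1.1 _ _) _.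
        by have := h y; lra.
    * exists r => //; apply: le_trans ((svalP r).1.2 _ _ t0) _.
      exact: ler_wpM2l.
  + by move=> x; exists (sval r0 x), r0.
  + by rewrite sublinear0//; exact: (svalP r).1.
  move=> q [sq qle _].
  have qp x : q x <= p x.
    by apply: le_trans (qle x (sval r0 x) _) ((svalP r0).2 x); exists r0.
  by exists (exist _ q (conj sq qp)) => s As; apply/asboolP => x; apply: qle;
    exists s.
exists q; split=> // r sr rq x; apply/eqP; rewrite eq_le rq/=.
have rp y : r y <= p y by exact: le_trans (rq y) (qp y).
by have /asboolP := qmax (exist _ r (conj sr rp)) ltac:(exact/asboolP).
Qed.

(* Minimality of [q], tested against the sublinear function
   [w |-> inf_(s >= 0) (q (w + s x) - s q x)], makes [q] superadditive. *)
Theorem hahn_banach p : sublinear p ->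
  exists2 f : E -> R^o, linear f & forall x, f x <= p x.
Proof.
move=> /minimal_sublinear[q [sq qp qmin]]; exists q => //.
have qD x y : q (x + y) = q x + q y.
  have [||a [s s0]|r [sr rle _]] :=
      @cone_envelope (fun w a => exists2 s, 0 <= s & q (w + s *: x) - s * q x <= a).
  - split=> [|v w a b [s s0 sa] [t t0 tb]|t w a t0 [s s0 sa]].
    + by exists 0 => //; rewrite scale0r mul0r addr0 sublinear0// subr0.
    + exists (s + t); first exact: addr_ge0.
      have := sq.1 (v + s *: x) (w + t *: x).
      by rewrite addrACA -scalerDl; lra.
    + exists (t * s); first exact: mulr_ge0.
      rewrite -scalerA -scalerDr sublinearZ// -mulrA -mulrBr.
      exact: ler_wpM2l.
  - by move=> w; exists (q w), 0 => //; rewrite scale0r mul0r addr0 subr0.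
  - by rewrite add0r sublinearZ// subrr.
  have rq w : r w <= q w.
    by apply: rle; exists 0 => //; rewrite scale0r mul0r addr0 subr0.
  apply/eqP; rewrite eq_le sq.1/= -lerBrDl -(qmin _ sr rq y).
  by apply: rle; exists 1 => //; rewrite scale1r mul1r [y + x]addrC.
have qN x : q (- x) = - q x.
  by apply/eqP; rewrite -addr_eq0 -qD addNr sublinear0.
move=> a x y; rewrite /= qD; congr (_ + _).
have [a0|a0] := leP 0 a; first exact: sublinearZ.
rewrite -[a]opprK scaleNr qN sublinearZ ?oppr_ge0 1?ltW//.
by rewrite -mulNr.
Qed.

(** The infimum of [b + p (w - z)] over [K z b] is sublinear and lies below both [p] and the
    constraints, so Hahn-Banach applies to it. The last hypothesis makes it finite. *)
Theorem mazur_orlicz p K : sublinear p -> cone_rel K ->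
  (forall z a, K z a -> 0 <= a + p (- z)) ->
  exists f : E -> R^o, [/\ linear f, forall x, f x <= p x &
    forall z a, K z a -> f z <= a].
Proof.
move=> sp [K0 KD KZ] Kp.
have [||a [z [b [Kzb]]]|q [sq qle _]] := @cone_envelope
    (fun w a => exists z b, K z b /\ b + p (w - z) <= a).
- split=> [|x y a b [z [c [Kz zc]]] [w [d [Kw wd]]]|t x a t0 [z [c [Kz zc]]]].
  + by exists 0, 0; rewrite subr0 sublinear0// addr0.
  + exists (z + w), (c + d); split; first exact: KD.
    by rewrite opprD addrACA; have := sp.1 (x - z) (y - w); lra.
  + exists (t *: z), (t * c); split; first exact: KZ.
    by rewrite -scalerBr sublinearZ// -mulrDr ler_wpM2l.
- by move=> w; exists (p w), 0, 0; rewrite subr0 add0r.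
- by rewrite sub0r; apply: le_trans; exact: Kp.
have [f lf fq] := hahn_banach sq; exists f; split=> // [x|z a Kza].
  apply: le_trans (fq _) _; apply: qle.
  by exists 0, 0; rewrite subr0 add0r.
apply: le_trans (fq _) _; apply: qle.
by exists z, a; rewrite subrr sublinear0// addr0.
Qed.

End HahnBanach.

(** * The dual of a normed space *)

Section DualTheory.
Context {R : realType} {X : normedModType R}.
Implicit Types (f g : dual X) (x y : X).

Lemma dual_linear f : linear f.
Proof. by case: f => f i; have /asboolP[] := i. Qed.

Lemma dual_continuous f : continuous f.
Proof. by case: f => f i; have /asboolP[] := i. Qed.

Lemma dualDr f x y : f (x + y) = (f x : R) + (f y : R) :> R.
Proof. by have := dual_linear f 1 x y; rewrite /= !scale1r. Qed.

Lemma dual0r f : f 0 = 0 :> R.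
Proof. by apply: (addrI (f 0)); rewrite -dualDr !addr0. Qed.

Lemma dualZr f a x : f (a *: x) = a * (f x : R) :> R.
Proof. by have := dual_linear f a x 0; rewrite !addr0 dual0r addr0. Qed.

Lemma dualNr f x : f (- x) = - (f x : R) :> R.
Proof. by rewrite -scaleN1r dualZr mulN1r. Qed.

Lemma dualBr f x y : f (x - y) = (f x : R) - (f y : R) :> R.
Proof. by rewrite dualDr dualNr. Qed.

Lemma dualDl f g x : (f + g) x = (f x : R) + (g x : R) :> R.
Proof. by []. Qed.

Lemma dualBl f g x : (f - g) x = (f x : R) - (g x : R) :> R.
Proof. by []. Qed.

Lemma dualZl a f x : (a *: f) x = a * (f x : R) :> R.
Proof. by []. Qed.

Lemma dual0l x : (0 : dual X) x = 0.
Proof. by []. Qed.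


Lemma bounded_linear_dual (f : X -> R^o) (N : R) :
  linear f -> (forall x, f x <= N * `|x|) -> exists g : dual X, forall x, g x = f x.
Proof.
move=> lf fN; pose F : {linear X -> R^o} := HB.pack f (GRing.isLinear.Build _ _ _ _ f lf).
have cf : continuous F.
  apply: bounded_linear_continuous; apply/linear_boundedP.
  near=> r => x; apply: (@le_trans _ _ (N * `|x|)); last first.
    by apply: ler_wpM2r => //; near: r; apply: nbhs_pinfty_ge; rewrite num_real.
  by rewrite ler_norml fN andbT lerNl -linearN -(normrN x) fN.
have fd : f \in linear_continuous_pred by apply/asboolP; split.
by exists (Dual fd).
Unshelve. all: by end_near. Qed.

Lemma normed_cone_hahn_banach (K : X -> R -> Prop) (N : R) :
  cone_rel K -> 0 <= N -> (forall z a, K z a -> 0 <= a + N * `|z|) ->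
  exists f : dual X, (forall x, f x <= N * `|x|) /\
    forall z a, K z a -> f z <= a.
Proof.
move=> cK N0 KN.
have [|z a /KN|f [lf fN fK]] := @mazur_orlicz _ _ (fun x => N * `|x|) K _ cK.
- split=> [x y|a x a0]; first by rewrite -mulrDr ler_wpM2l ?ler_normD.
  by rewrite normrZ ger0_norm// mulrCA.
- by rewrite normrN.
have [g gf] := bounded_linear_dual lf fN.
by exists g; split=> [x|z a Kza]; rewrite gf; [exact: fN|exact: fK].
Qed.

Lemma dual_unit x : x != 0 -> exists f : dual X, f x = 1.
Proof.
move=> x0; have nx : 0 < `|x| by rewrite normr_gt0.
have [|||f [_ fK]] := @normed_cone_hahn_banach
    (fun z a => z = a *: x) `|x|^-1.
- split=> [|y z a b -> ->|t z a _ ->]; first by rewrite scale0r.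
    by rewrite scalerDl.
  by rewrite scalerA.
- by rewrite invr_ge0.
- move=> z a ->; rewrite normrZ mulrCA mulVf ?gt_eqF// mulr1.
  by have := ler_norm (- a); rewrite normrN; lra.
exists f; apply/eqP; rewrite eq_le fK ?scale1r//=.
by have := fK (- x) (-1); rewrite scaleN1r dualNr lerN2; apply.
Qed.

Definition convex_cone (P : set X) :=
  [/\ P 0, forall x y, P x -> P y -> P (x + y) &
    forall t x, 0 <= t -> P x -> P (t *: x)].

(** The constraints are [f y - s * f x <= - s]. If [P] stays at distance [e] from [x], the cone [P]
    stays at distance [s * e] from [s *: x]; this is the bound required with [N = e^-1]. *)
Lemma convex_cone_separation (P : set X) x : convex_cone P -> ~ closure P x ->
  exists2 f : dual X, 1 <= f x & forall y, P y -> f y <= 0.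
Proof.
move=> [P0 PD PZ]; move=> ncl.
have [e e0 Pe] : exists2 e : R, 0 < e & forall y, P y -> e <= `|x - y|.
  apply: contrapT => h; apply: ncl => B /nbhs_ballP[e /= e0 eB].
  apply: contrapT => PB; apply: h; exists e => // y Py; rewrite leNgt.
  by apply/negP => xy; apply: PB; exists y; split=> //; apply: eB;
    rewrite -ball_normE.
have [|||f [_ fK]] := @normed_cone_hahn_banach
    (fun z a => exists y s, [/\ P y, 0 <= s, z = y - s *: x & a = - s]) e^-1.
- split=> [|y z a b [y' [s [Py s0 -> ->]]] [z' [t [Pz t0 -> ->]]]|t z a t0 [y [s [Py s0 -> ->]]]].
  + by exists 0, 0; rewrite scale0r subrr oppr0.
  + exists (y' + z'), (s + t); rewrite addr_ge0//.
    by split; [exact: PD|by []|rewrite scalerDl opprD addrACA|rewrite opprD].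
  + exists (t *: y), (t * s); rewrite mulr_ge0//.
    by split; [exact: PZ|by []|rewrite scalerBr scalerA|rewrite mulrN].
- by rewrite invr_ge0 ltW.
- move=> z a [y [s [Py s0 -> ->]]]; rewrite addrC subr_ge0.
  move: s0; rewrite le_eqVlt => /orP[/eqP <-|s0].
    by rewrite mulr_ge0// invr_ge0 ltW.
  rewrite ler_pdivlMl//.
  have /Pe : P (s^-1 *: y) by apply: PZ => //; rewrite invr_ge0 ltW.
  have -> : y - s *: x = - (s *: (x - s^-1 *: y)).
    by rewrite scalerBr scalerA divff ?gt_eqF// scale1r opprB.
  by rewrite normrN normrZ gtr0_norm// mulrC ler_pM2l.
exists f.
  by have := fK (0 - 1 *: x) (-1); rewrite sub0r scale1r dualNr lerN2; apply;
    exists 0, 1; rewrite sub0r scale1r.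
by move=> y Py; apply: fK; exists y, 0; rewrite scale0r subr0 oppr0.
Qed.

End DualTheory.

(** * Weak-star separation *)

Section ConeOver.
Context {R : realType} {E : lmodType R}.

Definition convex_rel (C : E -> R -> Prop) := forall x y a b t,
  0 <= t <= 1 -> C x a -> C y b ->
  C ((1 - t) *: x + t *: y) ((1 - t) * a + t * b).

Definition cone_over (C : E -> R -> Prop) (z : E) (a : R) :=
  exists s x b, [/\ 0 <= s, C x b, z = s *: x & a = s * b].

Lemma cone_rel_over (C : E -> R -> Prop) : (exists x a, C x a) ->
  convex_rel C -> cone_rel (cone_over C).
Proof.
move=> [x0 [a0 C0]] Cconv; split.
- by exists 0, x0, a0; rewrite scale0r mul0r.
- move=> _ _ _ _ [s [x [a [s0 Cx -> ->]]]] [t [y [b [t0 Cy -> ->]]]].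
  have [st0|st0] := eqVneq (s + t) 0.
    have [-> ->] : s = 0 /\ t = 0 by lra.
    by exists 0, x, a; rewrite !scale0r !mul0r !addr0.
  have st : 0 < s + t by rewrite lt_neqAle eq_sym st0 addr_ge0.
  exists (s + t), ((1 - t / (s + t)) *: x + (t / (s + t)) *: y),
    ((1 - t / (s + t)) * a + t / (s + t) * b); split; first exact: ltW.
  + apply: Cconv => //; rewrite divr_ge0 ?(ltW st)//=.
    by rewrite ler_pdivrMr// mul1r lerDr.
  + rewrite scalerDr !scalerA mulrBr mulr1 mulrC divfK//.
    by rewrite addrK.
  + by field.
- move=> t _ _ t0 [s [x [b [s0 Cx -> ->]]]].
  by exists (t * s), x, b; rewrite mulr_ge0// scalerA mulrA.
Qed.

End ConeOver.

Section WeakStar.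
Context {R : realType} {X : normedModType R}.
Implicit Types (f g : dual X) (A : set (dual X)).

Lemma dual_sum f (I : Type) (r : seq I) (P : pred I) (F : I -> X) :
  f (\sum_(i <- r | P i) F i) = \sum_(i <- r | P i) f (F i).
Proof. exact: (big_morph f (dualDr f) (dual0r f)). Qed.

Lemma weak_star_eval x : continuous ((fun f => f x) : weak_star X -> R).
Proof.
move=> f; apply: (@continuous_comp _ _ _ (dual_fun : weak_star X -> {ptws X -> R}) (fun h => h x)).
  exact: initial_continuous.
exact: proj_continuous.
Qed.

(** The sets [B (s, e)] generate a filter on [A] that converges to [f] pointwise, hence
    weak-star. *)
Lemma weak_star_closed_approx A f : weak_star_closed A ->
  (forall (s : seq X) e, 0 < e ->
     exists2 g, A g & forall x, x \in s -> `|f x - g x| < e) -> A f.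
Proof.
move=> Acl Af.
pose D := [set p : seq X * R | 0 < p.2].
pose B (p : seq X * R) := [set g | A g
  /\ forall x, x \in p.1 -> `|f x - g x| < p.2].
pose F : set_system (weak_star X) := filter_from D B.
have FF : ProperFilter F.
  apply: filter_from_proper => [|[s e] /= /(Af s)[g Ag gs]]; last by exists g.
  apply: filter_from_filter; first by exists ([::], 1); rewrite /D/= ltr01.
  move=> [s d] [t e] /= d0 e0; exists (s ++ t, Num.min d e).
    by rewrite /D /= lt_min; apply/andP.
  move=> g /= [Ag gst]; split; split=> // x xs;
    have := gst x; rewrite mem_cat xs ?orbT lt_min => /(_ isT)/andP[]//.
apply: (@closed_cvg (weak_star X) (weak_star X) F FF idfun A Acl _ f).
  by exists ([::], 1) => [|g []//] /=; exact: ltr01.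
move=> U; rewrite nbhsE => -[V [[W Wo WV] Vf] VU]; rewrite nbhs_filterE.
have FW : {ptws, dual_fun @ F --> (f : X -> R)}.
  apply/pointwise_cvgP => x; apply/cvgrPdist_lt => e e0.
  by exists ([:: x], e) => // g [_ /=]; apply; rewrite mem_seq1.
have : nbhs ((f : X -> R) : {ptws X -> R}) W.
  by apply: open_nbhs_nbhs; split=> //; move: Vf; rewrite -WV.
by move=> /FW[p Dp pW]; exists p => // g /pW Wg; apply: VU; rewrite -WV.
Qed.

(** Finitely many evaluations already keep [f] away from [A], so the problem becomes
    finite-dimensional: the vectors [c g] form a convex set whose l1 norms are at least [e]. *)
Lemma weak_star_separation A f : weak_star_closed A ->
  (forall g h t, 0 <= t <= 1 -> A g -> A h -> A ((1 - t) *: g + t *: h)) ->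
  ~ A f -> exists x, forall g, A g -> g x <= f x - 1.
Proof.
move=> Acl Aconv nAf.
have [[g0 Ag0]|/forallNP A0] := pselect (exists g, A g); last first.
  by exists 0 => g /A0.
have [s [e [e0 se]]] : exists (s : seq X) (e : R), 0 < e /\
    forall g, A g -> exists2 x, x \in s & e <= `|f x - g x|.
  apply: contrapT => h; apply: nAf; apply: weak_star_closed_approx => // s e e0.
  apply: contrapT => h'; apply: h; exists s, e; split=> // g Ag.
  apply: contrapT => h; apply: h'; exists g => // x xs; rewrite ltNge.
  by apply/negP => ex; apply: h; exists x.
pose u (i : 'I_(size s)) := s`_i.
pose c g : 'rV[R]_(size s) := \row_i (g (u i) - f (u i)).
have [|||phi [lphi _ phiK]] := @mazur_orlicz R 'rV[R]_(size s)
   (fun z => e^-1 * \sum_i `|z 0 i|) (cone_over (fun z a => exists2 g, A g & z = c g /\ a = -1)).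
- split=> [x y|a x a0].
    rewrite -mulrDr ler_pM2l ?invr_gt0// -big_split/= ler_sum// => i _.
    by rewrite mxE ler_normD.
  rewrite mulrCA ler_pM2l ?invr_gt0// mulr_sumr ler_sum// => i _.
  by rewrite mxE normrM ger0_norm.
- apply: cone_rel_over; first by exists (c g0), (-1), g0.
  move=> _ _ _ _ t t01 [g Ag [-> ->]] [h Ah [-> ->]].
  exists ((1 - t) *: g + t *: h); first exact: Aconv.
  split; last by lra.
  by apply/rowP => i; rewrite !mxE !dualDl !dualZl; lra.
- move=> _ _ [t [_ [_ [t0 [g Ag [-> ->]] -> ->]]]].
  have [_ /(nthP 0)[i si <-] ei] := se g Ag.
  rewrite mulrN1 addrC subr_ge0 ler_pdivlMl//.
  rewrite (bigD1 (Ordinal si))//=; apply: ler_wpDr; first exact: sumr_ge0.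
  by rewrite !mxE normrN normrM ger0_norm// mulrC ler_wpM2l// distrC.
pose Phi : {linear 'rV[R]_(size s) -> R^o} :=
  HB.pack phi (GRing.isLinear.Build _ _ _ _ phi lphi).
(* The coordinates of [phi] become the coefficients on the points of [s]. *)
exists (\sum_i phi (delta_mx 0 i) *: u i) => g Ag.
have := phiK (c g) (-1); rewrite (row_sum_delta (c g)).
rewrite -[phi]/(Phi : _ -> _) linear_sum/=.
have -> : \sum_i phi (c g 0 i *: delta_mx 0 i) =
   g (\sum_i phi (delta_mx 0 i) *: u i) - f (\sum_i phi (delta_mx 0 i) *: u i).
  rewrite !dual_sum -sumrB; apply: eq_bigr => i _.
  rewrite -[phi]/(Phi : _ -> _) linearZ !dualZr !mxE /= -mulrBr mulrC.
  by [].
move=> h; suff : g (\sum_i phi (delta_mx 0 i) *: u i) -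
    f (\sum_i phi (delta_mx 0 i) *: u i) <= -1 by lra.
apply: h; exists 1, (c g), (-1); rewrite scale1r mul1r; split=> //.
  by exists g.
exact/esym/row_sum_delta.
Qed.

End WeakStar.

(** * Baire category in closed subsets *)

(** Otherwise nested balls centred in [V] can be chosen, the [n]-th step avoiding [G n]; the centres
    converge to a point of [V] in no [G n]. *)
Theorem baire_closed_subset (R : realType) (X : completeNormedModType R)
    (V : set X) (G : nat -> set X) :
  closed V -> V !=set0 -> (forall n, closed (G n)) ->
  V `<=` \bigcup_n G n ->
  exists n c r, [/\ V c, 0 < r & forall x, V x -> `|x - c| < r -> G n x].
Proof.
move=> Vcl [v0 Vv0] Gcl VG; apply: contrapT => h.
have step (np : nat * (X * R)) : exists q : X * R, V np.2.1 -> 0 < np.2.2 ->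
    [/\ V q.1, 0 < q.2, q.2 <= np.1.+1%:R^-1 &
      forall y, `|y - q.1| <= q.2 -> `|y - np.2.1| <= np.2.2 /\ ~ G np.1 y].
  case: np => n [c r] /=.
  have [[Vc r0]|nVc] := pselect (V c /\ 0 < r); last first.
    by exists (c, r) => Vc r0; case: nVc.
  have [x [Vx xc nGx]] : exists x, [/\ V x, `|x - c| < r & ~ G n x].
    apply: contrapT => h'; apply: h; exists n, c, r; split=> // x Vx xc.
    by apply: contrapT => nGx; apply: h'; exists x.
  have /nbhs_ballP[e /= e0 eG] : nbhs x (~` G n).
    by apply: open_nbhs_nbhs; split=> //; exact: closed_openC.
  (* The three bounds on the radius give convergence, nesting and avoidance of [G n]. *)
  exists (x, Num.min n.+1%:R^-1 (Num.min (r - `|x - c|) (e / 2))) => _ _ /=.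
  split=> //.
  - by rewrite !lt_min invr_gt0 ltr0n subr_gt0 xc divr_gt0.
  - by rewrite ge_min lexx.
  move=> y; rewrite !le_min => /and3P[_ yr ye]; split.
    by have := ler_distD x y c; lra.
  by apply: eG; rewrite -ball_normE /= distrC; lra.
have [next nextP] := choice step.
pose fix a n := if n is m.+1 then next (m, a m) else (v0, 1).
have aV n : V (a n).1 /\ 0 < (a n).2.
  by elim: n => [|n [Va ra]] //=; have [] := nextP (n, a n) Va ra.
have aP n : (a n.+1).2 <= n.+1%:R^-1 /\
    forall y, `|y - (a n.+1).1| <= (a n.+1).2 ->
      `|y - (a n).1| <= (a n).2 /\ ~ G n y.
  by have [Va ra] := aV n; have [] := nextP (n, a n) Va ra.
have anest n k y : `|y - (a (k + n)%N).1| <= (a (k + n)%N).2 ->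
    `|y - (a n).1| <= (a n).2.
  by elim: k => // k IH; rewrite addSn => /(aP _).2[/IH].
have aa n m : (n <= m)%N -> `|(a m).1 - (a n).1| <= (a n).2.
  move=> /subnK <-; apply: (anest n (m - n)%N).
  by rewrite subrr normr0 ltW// (aV _).2.
have : cvg ((fun n => (a n).1) @ \oo).
  apply: cauchy_cvg; apply: cauchy_exP => e e0.
  have [n ne] : exists n, n.+1%:R^-1 < e.
    exists (Num.truncn e^-1); rewrite -[ltRHS]invrK ltf_pV2 ?posrE ?invr_gt0//.
    exact: truncnS_gt.
  exists (a n.+1).1; exists n.+1 => // m /= nm; rewrite -ball_normE /= distrC.
  by apply: le_lt_trans (aa _ _ nm) _; exact: le_lt_trans (aP n).1 ne.
move=> /cvg_ex[l al].
have Vl : V l by apply: (closed_cvg _ Vcl _ _ al); apply: nearW => n;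
  exact: (aV n).1.
have [n _ Gnl] := VG _ Vl.
have lan : `|l - (a n.+1).1| <= (a n.+1).2.
  apply: (@closed_cvg _ _ \oo _ (fun m => (a m).1)
     [set y | `|y - (a n.+1).1| <= (a n.+1).2]) al => /=;
       last by exists n.+1 => // m; exact: aa.
  have -> : [set y | `|y - (a n.+1).1| <= (a n.+1).2] =
      closed_ball (a n.+1).1 (a n.+1).2.
    rewrite closed_ballE ?(aV _).2//.
    by apply/seteqP; split=> y; rewrite /closed_ball_ /= distrC.
  exact: closed_ball_closed.
by have [_] := (aP n).2 _ lan.
Qed.

(** * Monotone operators and convex hulls of graphs *)

Section Affine.
Context {R : realType} {X : normedModType R}.
Implicit Types (A V D : set X) (x y u v w : X).

Definition linear_subspace V :=
  [/\ V 0, forall x y, V x -> V y -> V (x + y) & forall a x, V x -> V (a *: x)].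

Lemma linear_subspaceB V x y : linear_subspace V -> V x -> V y -> V (x - y).
Proof. by move=> [_ VD VZ] Vx Vy; rewrite -scaleN1r; apply/VD => //; exact: VZ. Qed.

Lemma affine_aff D : affine_set (aff D).
Proof. by move=> x y Dx Dy t A AD; apply: AD.1; [exact: Dx|exact: Dy]. Qed.

Lemma sub_aff D : D `<=` aff D.
Proof. by move=> x Dx A [_]; exact. Qed.

Lemma affine_direction A v : affine_set A -> A v ->
  linear_subspace [set w | A (v + w)].
Proof.
move=> Aaff Av.
have AZ a w : A (v + w) -> A (v + a *: w).
  move=> Aw; have := Aaff _ _ Av Aw a.
  by rewrite scalerDr addrA -scalerDl subrK scale1r.
split=> [|x y Ax Ay|a x] /=; [by rewrite addr0| |exact: AZ].
have := Aaff _ _ (AZ 2 _ Ax) (AZ 2 _ Ay) 2^-1.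
rewrite !scalerDr !scalerA addrACA -scalerDl subrK scale1r mulVf// scale1r.
by rewrite mulrBl mulVf// mul1r (_ : 2 - 1 = 1) ?scale1r//; lra.
Qed.

(** The algebraic interior relative to a subspace [V] of directions, which can then be shared by
    several points. *)
Definition core_point V D v :=
  D v /\ forall w, V w -> exists2 rho : R, 0 < rho &
    forall l, 0 <= l <= rho -> D (v + l *: w).

Lemma icP D v : ic D v <->
  closed (aff D) /\ core_point [set w | aff D (v + w)] D v.
Proof.
split=> [[cl [Dv h]]|[cl [Dv h]]]; split=> //; split=> // w Aw.
  have [rho rho0 Drho] := h _ Aw; exists rho => // l /Drho.
  by rewrite scalerDr addrA -scalerDl subrK scale1r.
have [|rho rho0 Drho] := h (w - v); first by rewrite /= addrC subrK.
exists rho => // l /Drho.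
by rewrite scalerBr scalerBl scale1r addrA addrAC.
Qed.

End Affine.

Section Monotone.
Context {R : realType} {X : normedModType R}.
Implicit Types (T : operator X) (V : set X) (x y z w : X) (f g h : dual X).

Definition related T x f := forall y g, T y g -> 0 <= (f - g : dual X) (x - y).

Lemma monotone_operatorP T :
  monotone_operator T <-> forall x f, T x f -> related T x f.
Proof.
split=> [mT x f Txf y g Tyg|mT [x f] [y g] Txf Tyg];
  first exact: (mT (x, f) (y, g)).
exact: mT Txf _ _ Tyg.
Qed.

Lemma maximal_monotoneP T : maximal_monotone T <->
  monotone_operator T /\ forall x f, related T x f -> T x f.
Proof.
split=> [[mT maxT]|[mT maxT]]; split=> //.
  move=> x f xf; apply: contrapT => nT; apply: maxT.
  exists (fun y => T y `|` [set g | y = x /\ g = f]).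
    apply/monotone_operatorP => y g [Tg|[-> ->]] y' g' [Tg'|[-> ->]].
    - exact: (mT (y, g) (y', g')).
    - by have := xf _ _ Tg; rewrite !dualBl !dualBr; lra.
    - exact: xf.
    - by rewrite dualBl subrr.
  split=> [[y g] /= Tg|]; first by left.
  by move=> /(_ (x, f) (or_intror (conj erefl erefl))); exact: nT.
move=> [S mS [TS nST]]; apply: nST => -[x f] /= Sxf; apply: maxT => y g Tyg.
by apply: (mS (x, f) (y, g)) => //; exact: TS (y, g) Tyg.
Qed.

(* The triples [(y, a, f)] are the convex combinations of the
   [(y_i, f_i y_i, f_i)] for [(y_i, f_i)] in the graph. *)
Inductive monotone_hull T : X -> R -> dual X -> Prop :=
| hull_graph y f of T y f : monotone_hull T y (f y) f
| hull_conv x a f y b g t of monotone_hull T x a f & monotone_hull T y b g &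
    0 <= t <= 1 :
    monotone_hull T ((1 - t) *: x + t *: y) ((1 - t) * a + t * b)
      ((1 - t) *: f + t *: g).

(** For fixed [(x, h)] the inequality is affine in [(y, a, f)], so it passes from the graph to
    convex combinations. *)
Lemma hull_related T x h y a f : related T x h -> monotone_hull T y a f ->
  h y - h x <= a - f x.
Proof.
move=> xh; elim=> {y a f} [y f Tyf|y a f z b g t _ IHy _ IHz /andP[t0 t1]].
  by have := xh _ _ Tyf; rewrite dualBl !dualBr; lra.
rewrite !dualDr !dualZr dualDl !dualZl; nra.
Qed.

(** The inequality is not affine in the triple. It is polarized into one that is affine in each of
    two triples; the diagonal gives [0 <= 2 * (a - f y)]. *)
Lemma hull_monotone T y a f : monotone_operator T -> monotone_hull T y a f ->
  f y <= a.
Proof.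
move=> /monotone_operatorP relT yaf.
suff : forall z b g, monotone_hull T z b g -> 0 <= a - f z - g y + b.
  by move=> /(_ _ _ _ yaf); lra.
move=> z b g; elim=> {z b g} [z g /relT zg|x b g z c h t _ IHx _ IHz /andP[t0 t1]].
  by have := hull_related zg yaf; lra.
rewrite !dualDr !dualZr dualDl !dualZl; nra.
Qed.

Lemma hull_sub T V y a f v : linear_subspace V ->
  (forall x, dom T x -> V (x - v)) -> monotone_hull T y a f -> V (y - v).
Proof.
move=> [V0 VD VZ] TV; elim=> {y a f} [y f Tyf|x a f y b g t _ Vx _ Vy _].
  by apply: TV; exists f.
have -> : (1 - t) *: x + t *: y - v = (1 - t) *: (x - v) + t *: (y - v).
  by rewrite !scalerBr addrACA -opprD -scalerDl subrK scale1r.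
by apply: VD; exact: VZ.
Qed.

(** The constraints [h w <= b] over these pairs say that [(z, h)] is monotonically related to
    [T]. *)
Definition hull_at T z (w : X) (b : R) := exists y a f,
  [/\ monotone_hull T y a f, w = y - z & b = a - f z].

Lemma hull_at_convex T z : convex_rel (hull_at T z).
Proof.
move=> _ _ _ _ t t01 [y [a [f [yaf -> ->]]]] [x [b [g [xbg -> ->]]]].
do 3 eexists; split; first exact: hull_conv yaf xbg t01.
  by rewrite !scalerBr addrACA -opprD -scalerDl subrK scale1r.
by rewrite dualDl !dualZl; lra.
Qed.

Lemma hull_at_graph T z y f : T y f -> hull_at T z (y - z) (f (y - z)).
Proof. by move=> Tyf; exists y, (f y), f; split=> //;
  [exact: hull_graph|rewrite dualBr]. Qed.

Lemma hull_at_related T z f : (forall w b, hull_at T z w b -> f w <= b) ->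
  related T z f.
Proof.
move=> fle y g Tyg; have := fle _ _ (hull_at_graph z Tyg).
by rewrite dualBl !dualBr; lra.
Qed.

(** The sets to which Baire is applied: over all natural [n] they cover the domain. *)
Definition bounded_level T (n : R) :=
  [set z | exists2 f, T z f & forall x, f x <= n * `|x|].

(** At a point [x] of the level set, [hull_related] gives [a - f x >= - n * |y - x|] on the hull.
    This survives the limit and is the bound needed to extend to a functional of norm at most [n]
    related to [T] at [z]. *)
Lemma bounded_level_closed T n : maximal_monotone T -> 0 <= n ->
  closed (bounded_level T n).
Proof.
move=> /maximal_monotoneP[mT maxT] n0 z clz.
have [z0 [f0 Tf0 _]] : bounded_level T n !=set0.
  by have [y []] := clz setT filterT; exists y.
have zn y a f : monotone_hull T y a f -> 0 <= a - f z + n * `|y - z|.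
  move=> yaf; pose phi x : R := a - f x + n * `|y - x|.
  have phic : continuous phi.
    move=> x; apply: cvgD; first by apply: cvgB;
      [exact: cvg_cst|exact: dual_continuous].
    by apply: cvgMr; apply: cvg_norm; apply: cvgB; [exact: cvg_cst|exact: cvg_id].
  have clphi : closed [set x | 0 <= phi x].
    by apply: closed_comp (@closed_ge _ 0) => x _; exact: phic.
  apply: (clphi z) => B /clz [x [[g Txg gn] Bx]]; exists x; split=> //=.
  have /monotone_operatorP/(_ _ _ Txg) xg := mT.
  have := hull_related xg yaf; have := gn (x - y).
  by rewrite /phi dualBr (distrC x y); lra.
have [|w b [s [_ [_ [s0 [y [a [f [yaf -> ->]]]] -> ->]]]]|f [fn fK]] :=
    @normed_cone_hahn_banach _ _ (cone_over (hull_at T z)) n _ n0.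
- apply: cone_rel_over; last exact: hull_at_convex.
  by exists (z0 - z), (f0 (z0 - z)); exact: hull_at_graph.
- by rewrite normrZ ger0_norm// mulrCA -mulrDr mulr_ge0// zn.
exists f => //; apply/maxT/hull_at_related => w b zwb.
by apply: fK; exists 1, w, b; rewrite scale1r mul1r.
Qed.

End Monotone.

(** * Values of a maximal operator prescribed in one direction *)

Section Extension.
Context {R : realType} {X : normedModType R}.
Implicit Types (T : operator X) (V : set X) (x y z w : X) (f g h : dual X).

(* The functional sought is dominated by [b] on the cone [K] of pairs [(w, b)]
   generated by the [(y - z, g (y - z))] for [g] in [T y] and by [+-(d, s)].
   The ball on which [T] is bounded gives [b >= - N |w|] on [K]. *)
Lemma value_attained T V c r n z d s :
  maximal_monotone T -> linear_subspace V -> (forall x, dom T x -> V (x - c)) ->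
  0 < r -> 0 <= n ->
  (forall w, V w -> `|w| < r -> bounded_level T n (c + w)) ->
  V (z - c) -> V d -> (d = 0 -> s = 0) ->
  (forall y a f t, monotone_hull T y a f -> y - z = t *: d -> t * s <= a - f z) ->
  (exists k y a f t, [/\ 0 <= k, monotone_hull T y a f &
     z - c = k *: (y - z) + t *: d]) ->
  exists2 f, T z f & f d = s.
Proof.
move=> /maximal_monotoneP[mT maxT] Vsub TV r0 n0 Tball Vzc Vd ds0 hullz.
move=> [k [y0 [a0 [f0 [t0 [k0 hull0 zc]]]]]].
have [V0 VD VZ] := Vsub.
pose K w b := exists w' b' t,
  [/\ cone_over (hull_at T z) w' b', w = w' + t *: d & b = b' + t * s].
have [C0 CD CZ] : cone_rel (cone_over (hull_at T z)).
  apply: cone_rel_over; last exact: hull_at_convex.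
  by exists (y0 - z), (a0 - f0 z), y0, a0, f0.
have Kcone : cone_rel K.
  split.
  - by exists 0, 0, 0; rewrite scale0r mul0r !addr0.
  - move=> _ _ _ _ [w [a [t [Cw -> ->]]]] [w' [a' [t' [Cw' -> ->]]]].
    exists (w + w'), (a + a'), (t + t'); split; first exact: CD.
      by rewrite scalerDl addrACA.
    by rewrite mulrDl addrACA.
  - move=> u _ _ u0 [w [a [t [Cw -> ->]]]].
    exists (u *: w), (u * a), (u * t); split; first exact: CZ.
      by rewrite scalerDr scalerA.
    by rewrite mulrDr mulrA.
have [_ KD KZ] := Kcone.
have hullK y a f : monotone_hull T y a f -> K (y - z) (a - f z).
  move=> yaf; exists (y - z), (a - f z), 0; rewrite scale0r mul0r !addr0.
  by split=> //; exists 1, (y - z), (a - f z); rewrite scale1r mul1r; split=> //;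
    exists y, a, f.
have dK t : K (t *: d) (t * s) by exists 0, 0, t; rewrite !add0r.
have KV w b : K w b -> V w.
  move=> [_ [_ [t [[u [_ [_ [_ [y [a [f [yaf -> _]]]] -> _]]]] -> _]]]].
  apply: VD; last exact: VZ.
  apply: VZ; have -> : y - z = (y - c) - (z - c) by rewrite opprB addrA subrK.
  apply: linear_subspaceB => //; exact: hull_sub yaf.
have K0 b : K 0 b -> 0 <= b.
  move=> [_ [_ [t [[u [_ [_ [u0 [y [a [f [yaf -> ->]]]] -> ->]]]] wd ->]]]].
  move: u0; rewrite le_eqVlt => /orP[/eqP u0|u0].
    move: wd; rewrite -u0 scale0r add0r mul0r add0r => /esym/eqP.
    by rewrite scaler_eq0 => /orP[/eqP -> |/eqP/ds0 ->]; rewrite ?mul0r ?mulr0.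
  (* A pair over 0 with [u > 0] makes [y - z] a multiple of [d], the case covered by [hullz]. *)
  have yz : y - z = (- t / u) *: d.
    have /esym/eqP := congr1 (fun v => u^-1 *: v) wd.
    rewrite scaler0 scalerDr !scalerA mulVf ?gt_eqF// scale1r addr_eq0.
    by move=> /eqP ->; rewrite -scaleNr mulNr mulrC.
  have := hullz _ _ _ _ yaf yz; rewrite mulrAC ler_pdivrMr// => ?; lra.
(* [w] splits as [(c + w - z) + (z - c)]: the first term comes from a value of [T] bounded by [n],
   the second from the last hypothesis. *)
pose M := n * (r + `|c - z|) + (k * (a0 - f0 z) + t0 * s).
have Kle w : V w -> `|w| < r -> exists2 b, K w b & b <= M.
  move=> Vw wr; have [g Tg gn] := Tball w Vw wr.
  exists (g (c + w - z) + (k * (a0 - f0 z) + t0 * s)).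
    rewrite [X in K X _](_ : w = (c + w - z) + (k *: (y0 - z) + t0 *: d));
      last first.
      by rewrite -zc addrA subrK addrAC subrr add0r.
    apply: (KD); last by apply: (KD); [exact: KZ (hullK _ _ _ hull0)|exact: dK].
    by have := hullK _ _ _ (hull_graph Tg); rewrite -dualBr.
  rewrite lerD2r; apply: le_trans (gn _) _; apply: ler_wpM2l => //.
  by rewrite addrAC addrC (le_trans (ler_normD _ _))// lerD2r ltW.
have [N N0 KN] : exists2 N, 0 <= N & forall w b, K w b -> 0 <= b + N * `|w|.
  exists (2 * `|M| / r); first by rewrite divr_ge0 ?mulr_ge0// ltW.
  move=> w b Kwb; have [w0|w0] := eqVneq w 0.
    by rewrite w0 normr0 mulr0 addr0; apply: K0; rewrite -w0.
  have nw : 0 < `|w| by rewrite normr_gt0.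
  (* The multiple of [- w] of norm [r / 2] carries a pair bounded by [M]; adding a multiple of that
     pair to [(w, b)] lands over 0, where [K0] applies. *)
  have [||b' Kb' b'M] := Kle (- (r / (2 * `|w|)) *: w).
  - by apply: VZ; exact: KV Kwb.
  - rewrite normrZ normrN ger0_norm ?divr_ge0 ?mulr_ge0 ?(ltW r0)//.
    by have -> : r / (2 * `|w|) * `|w| = r / 2; [by field; rewrite gt_eqF|lra].
  have : K 0 (b + (2 * `|w| / r) * b').
    have -> : (0 : X) = w + (2 * `|w| / r) *: (- (r / (2 * `|w|)) *: w).
      rewrite scalerA mulrN (_ : _ / r * _ = 1) ?scaleN1r ?subrr//.
      by field; rewrite !gt_eqF.
    by apply: (KD) => //; apply: KZ => //; rewrite divr_ge0 ?mulr_ge0 ?(ltW r0).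
  move=> /K0 /le_trans; apply; rewrite lerD2l.
  have -> : 2 * `|M| / r * `|w| = (2 * `|w| / r) * `|M| by field; rewrite gt_eqF.
  apply: ler_wpM2l; first by rewrite divr_ge0 ?mulr_ge0 ?(ltW r0).
  by apply: le_trans b'M _; exact: ler_norm.
have [g [_ gK]] := normed_cone_hahn_banach Kcone N0 KN.
exists g.
  apply/maxT/hull_at_related => w b [y [a [f [yaf -> ->]]]].
  by apply: gK; exact: hullK.
apply/eqP; rewrite eq_le; apply/andP; split.
  by apply: gK; have := dK 1; rewrite scale1r mul1r.
by have := gK _ _ (dK (-1)); rewrite scaleN1r mulN1r dualNr lerN2.
Qed.

End Extension.

(** * Adding the normal cone of a line *)

Section Lines.
Context {R : realType} {X : normedModType R}.
Implicit Types (T : operator X) (L : set X) (x y v d : X) (f g : dual X).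

Definition line v d : set X := [set v + t *: d | t in [set: R]].

Lemma lineB v d t u : (v + t *: d) - (v + u *: d) = (t - u) *: d.
Proof. by rewrite opprD addrACA subrr add0r scalerBl. Qed.

Lemma normal_cone_line v d t f :
  normal_cone (line v d) (v + t *: d) f <-> f d = 0.
Proof.
split=> [[_ fL]|fd]; last first.
  split=> [|_ [u _ <-]]; first by exists t.
  by rewrite lineB dualZr fd mulr0.
have := fL _ (ex_intro2 _ _ (t + 1) I erefl).
have := fL _ (ex_intro2 _ _ (t - 1) I erefl).
rewrite !lineB !dualZr => ? ?.
by apply/eqP; rewrite eq_le; apply/andP; split; lra.
Qed.

Lemma lineP L v : is_line L -> L v -> exists2 d, d != 0 & L = line v d.
Proof.
move=> [p [d [d0 ->]]] [t0 _ <-]; exists d => //.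
apply/seteqP; split=> _ [t _ <-].
  by exists (t - t0) => //; rewrite -addrA -scalerDl [t0 + _]addrC subrK.
by exists (t0 + t) => //; rewrite scalerDl addrA.
Qed.

(** The maximality clause for the operator [t |-> [set g d | g in T (v + t *: d)]] on the real
    line. *)
Definition line_maximal T v d := forall t s,
  (forall u g, T (v + u *: d) g -> 0 <= (t - u) * (s - g d)) ->
  exists2 g, T (v + t *: d) g & g d = s.

Lemma maximal_add_normal_lineP T v d : monotone_operator T -> dom T v -> d != 0 ->
  maximal_monotone (op_add T (normal_cone (line v d))) <-> line_maximal T v d.
Proof.
move=> mT [h0 Tv] d0; have [g0 g0d] := dual_unit d0.
rewrite maximal_monotoneP; split=> [[_ maxTL] t s ts|maxT].
  have : related (op_add T (normal_cone (line v d))) (v + t *: d) (s *: g0).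
    move=> y _ [h Ty [n ny <-]]; have [[u _ yE] _] := ny; subst y.
    move/normal_cone_line: ny => nd.
    rewrite lineB dualZr dualBl dualZl dualDl g0d nd.
    by rewrite mulr1 addr0; exact: ts.
  move=> /maxTL[g Tg [n /normal_cone_line nd sE]]; exists g => //.
  by have := congr1 (fun f : dual X => f d : R) sE; rewrite dualDl dualZl nd g0d;
    lra.
split=> [|x f xf].
  apply/monotone_operatorP => x _ [g Tx [n nx <-]] y _ [h Ty [m my <-]].
  have [[t _ xE] _] := nx; have [[u _ yE] _] := my.
  have := (monotone_operatorP T).1 mT _ _ Tx _ _ Ty.
  move: nx my; rewrite -{}xE -{}yE => /normal_cone_line nd /normal_cone_line md.
  rewrite lineB !dualZr.
  by rewrite !dualBl !dualDl nd md !addr0.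
have [t xE] : exists t, x = v + t *: d.
  (* Off the line, some [n] vanishes on [d] and equals 1 at [x - v]. It is normal to the line, and
     adding [c *: n] to [h0] at [v] makes the pairing with [(x, f)] equal to -1. *)
  apply: contrapT => xL; set e := x - v - g0 (x - v) *: d.
  have [h he] : exists h : dual X, h e = 1.
    apply: dual_unit; apply/eqP => e0; apply: xL; exists (g0 (x - v)).
    by move/eqP: e0; rewrite subr_eq0 => /eqP <-; rewrite addrC subrK.
  pose n := h - (h d : R) *: g0.
  have nd : n d = 0 by rewrite /n dualBl dualZl g0d mulr1 subrr.
  have nx : n (x - v) = 1.
    by rewrite -[RHS]he [in RHS]dualBr dualZr dualBl dualZl mulrC.
  pose c : R := (f - h0) (x - v) + 1.
  have /xf : op_add T (normal_cone (line v d)) v (h0 + c *: n).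
    exists h0 => //; exists (c *: n) => //.
    rewrite -[X in normal_cone _ X]addr0 -(scale0r d).
    by apply/normal_cone_line; rewrite dualZl nd mulr0.
  by rewrite opprD addrA dualBl dualZl nx mulr1 /c; lra.
rewrite {}xE in xf *; have [|g Tg gd] := maxT t (f d).
  move=> u h Tu; have : op_add T (normal_cone (line v d)) (v + u *: d) (h + 0).
    by exists h => //; exists 0 => //; apply/normal_cone_line.
  by move=> /xf; rewrite addr0 lineB dualZr dualBl.
exists g => //; exists (f - g); last by rewrite addrC subrK.
by apply/normal_cone_line; rewrite dualBl gd subrr.
Qed.

End Lines.

(** * Operators that are maximal monotone *)

Section Absorbing.
Context {R : realType} {X : completeNormedModType R}.
Implicit Types (T : operator X) (V D : set X) (v d w x y : X) (f g : dual X).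

Lemma dual_bounded f : exists n : nat, forall x, f x <= n%:R * `|x|.
Proof.
pose F : {linear X -> R^o} := HB.pack (f : X -> R^o)
  (GRing.isLinear.Build _ _ _ _ (f : X -> R^o) (dual_linear f)).
have /continuous_linear_bounded/linear_boundedP : {for 0, continuous F}.
  exact: dual_continuous.
move=> /pinfty_ex_gt0[r r0 Fr]; exists (Num.truncn r).+1 => x.
apply: le_trans (ler_norm _) _; apply: le_trans (Fr x) _.
by rewrite ler_wpM2r// ltW// truncnS_gt.
Qed.

(** [V] is covered by the sets of [w] with [v + w / (k + 1)] in [F n], the pairs [(k, n)] being
    coded by one index. Baire gives one of them a ball, which is then scaled down. *)
Lemma absorbing_ball V (F : nat -> set X) v :
  closed V -> linear_subspace V -> (forall n, closed (F n)) ->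
  (forall w, V w -> exists2 rho, 0 < rho &
     forall l, 0 <= l <= rho -> exists n, F n (v + l *: w)) ->
  exists n c r, [/\ V c, 0 < r & forall w, V w -> `|w - c| < r -> F n (v + w)].
Proof.
move=> Vcl [V0 _ VZ] Fcl Vabs.
pose G m := if unpickle m is Some (k, n) then
  [set w | F n (v + (k.+1%:R : R)^-1 *: w)] else set0.
have [|m|w /Vabs[rho rho0 wF]|m [c [r [Vc r0 cG]]]] := @baire_closed_subset R X V G Vcl.
- by exists 0.
- rewrite /G; case: unpickle => [[k n]|]; last exact: closed0.
  apply: closed_comp (Fcl n) => w _.
  by apply: cvgD; [exact: cvg_cst|apply: cvgZl_tmp; exact: cvg_id].
- have [|n Fn] := wF (Num.truncn rho^-1).+1%:R^-1.
    rewrite invr_ge0 ler0n/= -[leRHS]invrK lef_pV2 ?posrE ?invr_gt0//.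
    by rewrite ltW// truncnS_gt.
  by exists (pickle (Num.truncn rho^-1, n)) => //; rewrite /G pickleK.
move: cG; rewrite /G; case: unpickle => [[k n]|cG]; last first.
  by have [] := cG c Vc _; rewrite subrr normr0.
move=> cF; have k0 : 0 < k.+1%:R :> R by rewrite ltr0n.
exists n, (k.+1%:R^-1 *: c), (k.+1%:R^-1 * r); split;
  [exact: VZ|by rewrite mulr_gt0 ?invr_gt0|].
move=> w Vw wc; have := cF (k.+1%:R *: w) (VZ _ _ Vw).
rewrite /= scalerA mulVf ?gt_eqF// scale1r; apply.
have -> : k.+1%:R *: w - c = k.+1%:R *: (w - k.+1%:R^-1 *: c).
  by rewrite scalerBr scalerA divff ?gt_eqF// scale1r.
by rewrite normrZ gtr0_norm// -ltr_pdivlMl.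
Qed.

End Absorbing.

Lemma affine_ge0_left (R : realType) (p q a b : R) : a < b ->
  (forall x, a < x < b -> 0 <= p + x * q) -> 0 <= p + a * q.
Proof.
move=> ab pq; rewrite leNgt; apply/negP => lt0.
have [q0|q0] := leP q 0.
  by have := pq ((a + b) / 2) ltac:(by apply/andP; split; lra); nra.
(* Half the distance from [a] to the zero of the affine function, which is thus still negative at
   [a + e]. *)
pose e := - (p + a * q) / (2 * q).
have e0 : 0 < e by rewrite divr_gt0; lra.
have eq : e * q = - (p + a * q) / 2 by rewrite /e; field; rewrite gt_eqF.
have [ea|ea] := leP (a + e) ((a + b) / 2).
  by have := pq (a + e) ltac:(by apply/andP; split; lra); nra.
by have := pq ((a + b) / 2) ltac:(by apply/andP; split; lra); nra.
Qed.

Lemma affine_ge0_right (R : realType) (p q a b : R) : a < b ->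
  (forall x, a < x < b -> 0 <= p + x * q) -> 0 <= p + b * q.
Proof.
move=> ab pq; rewrite -[b]opprK mulNr -mulrN;
  apply: (@affine_ge0_left _ _ _ _ (- a)); first by lra.
by move=> x xab; have := pq (- x) ltac:(lra); rewrite mulNr mulrN.
Qed.

(** * Domain and line restrictions of a maximal operator *)

Section Maximal.
Context {R : realType} {X : completeNormedModType R}.
Variables (T : operator X) (V : set X) (v : X).
Hypotheses (maxT : maximal_monotone T) (Vcl : closed V) (Vsub : linear_subspace V)
  (TV : forall x, dom T x -> V (x - v)) (corev : core_point V (dom T) v).
Implicit Types (d w x y : X) (f g : dual X).

Lemma bounded_level_ball : exists n c r, [/\ 0 < r, V (c - v) &
  forall w, V w -> `|w| < r -> bounded_level T n%:R (c + w)].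
Proof.
have [n||n [c [r [Vc r0 cT]]]] :=
    @absorbing_ball _ _ V (fun n => bounded_level T n%:R) v Vcl Vsub.
- exact: bounded_level_closed.
- move=> w Vw; have [rho rho0 Tw] := corev.2 w Vw; exists rho => // l /Tw[f Tf].
  by have [n fn] := dual_bounded f; exists n, f.
exists n, (v + c), r; split=> //; first by rewrite addrAC subrr add0r.
have [_ VD _] := Vsub; move=> w Vw wr; rewrite -addrA; apply: cT; first exact: VD.
by rewrite addrAC subrr add0r.
Qed.

Let Vz c z : V (c - v) -> V (z - v) -> V (z - c).
Proof.
move=> Vc Vz; have -> : z - c = (z - v) - (c - v) by rewrite opprB addrA subrK.
exact: linear_subspaceB.
Qed.

Let TVc c x : V (c - v) -> dom T x -> V (x - c).
Proof. by move=> Vc /TV; exact: Vz. Qed.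

Let convDE y w l : (1 - l) *: v + w + l *: y = v + l *: (y - v) + w.
Proof.
rewrite scalerBl scale1r scalerBr addrAC; congr (_ + w).
by rewrite -addrA [- _ + _]addrC.
Qed.

(* In particular the interior of the convex hull of the domain lies in the
   domain. *)
Lemma core_hull y a f l : monotone_hull T y a f -> 0 <= l < 1 ->
  dom T (v + l *: (y - v)).
Proof.
move=> yaf /andP[l0 l1]; have [V0 VD VZ] := Vsub.
have [n [c [r [r0 Vc Tc]]]] := bounded_level_ball.
set z := v + l *: (y - v).
have Vzv : V (z - v).
  by rewrite /z addrAC subrr add0r; apply: VZ; exact: hull_sub yaf.
have Vzc := Vz Vc Vzv.
have [rho rho0 Trho] := corev.2 _ Vzc;
  have [h Th] := Trho rho ltac:(by rewrite ltW// lexx).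
(* With [d = 0] and [s = 0] no value is prescribed; only the existence of [g] is at stake. *)
have [||||||g Tg _] := @value_attained _ _ T V c r n%:R z 0 0 maxT Vsub _ r0 _ Tc Vzc; last first.
- by exists g.
(* Combining the domain point [v + rho *: (z - c)] with [y] at weight [l] gives
   [z + ((1 - l) * rho) *: (z - c)]. *)
- exists (((1 - l) * rho)^-1).
  have l01 : 0 <= l <= 1 by rewrite l0 ltW.
  do 3 eexists; exists 0; split; [|exact: hull_conv (hull_graph Th) yaf l01| ].
    by rewrite invr_ge0 mulr_ge0 ?subr_ge0 ?(ltW l1)// ltW.
  rewrite scaler0 addr0 [(1 - l) *: (v + _)]scalerDr scalerA convDE -/z [z + _]addrC addrK scalerA.
  by rewrite mulVf ?scale1r// mulf_neq0 ?gt_eqF// subr_gt0.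
- move=> y' a' f' t yaf'; rewrite scaler0 mulr0 => /eqP;
  rewrite subr_eq0 => /eqP <-.
  by rewrite subr_ge0; apply: hull_monotone yaf'; exact: maxT.1.
- by [].
- exact: V0.
- exact: ler0n.
- by move=> x; exact: TVc.
Qed.

Lemma core_line y a f d t u : monotone_hull T y a f -> y = v + t *: d ->
  0 <= u < t -> dom T (v + u *: d).
Proof.
move=> yaf yE /andP[u0 ut]; have t0 : 0 < t by exact: le_lt_trans ut.
have := core_hull yaf (_ : 0 <= u / t < 1).
rewrite yE addrAC subrr add0r scalerA divfK ?gt_eqF//; apply.
by rewrite divr_ge0 ?(ltW t0)//= ltr_pdivrMr// mul1r.
Qed.

Lemma line_value_attained d t s : V d -> d != 0 -> 0 <= t ->
  (forall u, 0 <= u < t -> dom T (v + u *: d)) ->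
  (forall u g, T (v + u *: d) g -> 0 <= (t - u) * (s - g d)) ->
  exists2 g, T (v + t *: d) g & g d = s.
Proof.
move=> Vd d0 t0 Tt ts; have [V0 VD VZ] := Vsub.
have [n [c [r [r0 Vc Tc]]]] := bounded_level_ball.
have Vzc : V (v + t *: d - c).
  by apply: Vz => //; rewrite addrAC subrr add0r; exact: VZ.
have [rho rho0 Trho] := corev.2 _ Vzc;
  have [h Th] := Trho rho ltac:(by rewrite ltW// lexx).
apply: (@value_attained _ _ T V c r n%:R _ d s maxT Vsub _ r0 _ Tc Vzc Vd) => //.
- by move=> x; exact: TVc.
- by move/eqP; rewrite (negbTE d0).
- move=> y a f tau yaf yt.
  have yE : y = v + (t + tau) *: d.
    by rewrite scalerDl addrA -yt addrC subrK.
  have key u g : T (v + u *: d) g ->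
      (t + tau - u) * (g d) <= a - f v - u * f d.
    move=> Tg; have := hull_related ((monotone_operatorP T).1 maxT.1 _ _ Tg) yaf.
    by rewrite yE !dualDr !dualZr; lra.
  (* For [u] strictly between [t] and [t + tau], close enough to [t], [ts] compares [g d] with [s],
     and [key] yields this inequality with factor [u] in place of the last [t]. Then [u] tends to
     [t]. *)
  suff : 0 <= (a - f v - (t + tau) * s) + t * (s - f d).
    by rewrite dualDr dualZr; lra.
  have [tau0|tau0|tau0] := ltgtP tau 0; last first.
  + have := hull_monotone maxT.1 yaf.
    by rewrite yE tau0 addr0 dualDr dualZr; lra.
  + apply: (@affine_ge0_left _ _ _ _ (t + tau)); first lra.
    move=> u tu; have [g Tg] : dom T (v + u *: d).
      by apply: (core_line yaf yE); apply/andP; split; lra.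
    have sg : s <= g d by have := ts _ _ Tg; nra.
    by have := key _ _ Tg; nra.
  (* Domain points just below [t] come from [Tt] if [t > 0], and from the core property at [v] if
     [t = 0]. *)
  have [m [mt tm Tm]] : exists m, [/\ m < t, t + tau <= m &
      forall u, m < u < t -> dom T (v + u *: d)].
    move: t0; rewrite le_eqVlt => /orP[/eqP t0|t0].
      have [e e0 Te] := corev.2 (- d) ltac:(by rewrite -scaleN1r; exact: VZ).
      exists (Num.max (- e) tau); split=> [||u].
      - by rewrite gt_max; apply/andP; split; lra.
      - by rewrite -t0 add0r le_max lexx orbT.
      - rewrite gt_max => /andP[/andP[ue _] ut].
        by have := Te (- u) ltac:(apply/andP; split; lra);
          rewrite scalerN scaleNr opprK.
    exists (Num.max 0 (t + tau)); split=> [||u].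
    - by rewrite gt_max; apply/andP; split; lra.
    - by rewrite le_max lexx orbT.
    - rewrite gt_max => /andP[/andP[u0 _] ut].
      by apply: Tt; rewrite ltW.
  apply: (@affine_ge0_right _ _ _ m) => // u mut.
  have [g Tg] := Tm _ mut.
  have sg : g d <= s by have := ts _ _ Tg; nra.
  by have := key _ _ Tg; nra.
- exists rho^-1, (v + rho *: (v + t *: d - c)), (h (v + rho *: (v + t *: d - c))), h, (t / rho).
  split; [by rewrite invr_ge0 ltW|exact: hull_graph|].
  rewrite opprD addrACA subrr add0r scalerBr !scalerA mulVf ?gt_eqF// scale1r.
  by rewrite mulrC subrK.
Qed.

Lemma line_maximal_ray d t s : V d -> d != 0 -> 0 <= t ->
  (forall u g, T (v + u *: d) g -> 0 <= (t - u) * (s - g d)) ->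
  exists2 g, T (v + t *: d) g & g d = s.
Proof.
move=> Vd d0 t0 ts.
have [Tt|] := pselect (forall u, 0 <= u < t -> dom T (v + u *: d)).
  exact: line_value_attained.
move=> /existsNP[t1 /not_implyP[/andP[t10 t1t] nTt1]].
have ubt1 u : dom T (v + u *: d) -> u <= t1.
  move=> [g Tg]; rewrite leNgt; apply/negP => t1u; apply: nTt1.
  by apply: core_line (hull_graph Tg) erefl _; rewrite t10.
pose S := [set u | dom T (v + u *: d)].
have S0 : S 0 by rewrite /S /= scale0r addr0; exact: corev.1.
have hS : has_sup S by split; [exists 0|exists t1].
have b0 : 0 <= sup S by apply: ub_le_sup => //; exact: hS.2.
have bt1 : sup S <= t1 by apply: ge_sup => //; exists 0.
(* If the domain stopped at [sup S < t], then arbitrarily large slopes would be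
   attained there, which contradicts the bound given by [(t, s)]. *)
have [||g Tg gd] := @line_value_attained d (sup S) (s + 1) Vd d0 b0.
- move=> u /andP[u0 /(sup_gt hS.1)[u' [g Tg] uu']].
  by apply: core_line (hull_graph Tg) erefl _; rewrite u0.
- move=> u g Tg; have uS : u <= sup S by apply: ub_le_sup; [exact: hS.2|exists g].
  by have := ts _ _ Tg; have := ubt1 u (ex_intro _ g Tg); nra.
by have := ts _ _ Tg; rewrite gd; nra.
Qed.

Lemma maximal_line_maximal d : V d -> d != 0 -> line_maximal T v d.
Proof.
move=> Vd d0 t s ts; have [t0|t0] := leP 0 t; first exact: line_maximal_ray.
have [|||u g Tg|g Tg gd] := @line_maximal_ray (- d) (- t) (- s).
- by have [_ _ VZ] := Vsub; rewrite -scaleN1r; exact: VZ.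
- by rewrite oppr_eq0.
- by rewrite oppr_ge0 ltW.
- have := ts (- u) g; rewrite scaleNr -scalerN => /(_ Tg).
  by rewrite dualNr; lra.
exists g; first by move: Tg; rewrite scaleNr scalerN opprK.
by apply: oppr_inj; rewrite -gd dualNr.
Qed.

End Maximal.

(** * Operators that are maximal along lines *)

Section Conditions.
Context {R : realType} {X : normedModType R}.
Implicit Types (T : operator X) (x y : X) (f g h : dual X).

(** By maximality [T x] is the intersection of the half-spaces [g (x - y) <= h (x - y)] in [h], for
    [g] in [T y]. *)
Lemma maximal_weak_star_closed T x : maximal_monotone T -> weak_star_closed (T x).
Proof.
move=> /maximal_monotoneP[/monotone_operatorP mT maxT] f clf; apply: maxT => y g Tg.
have C : @closed (weak_star X) [set h | g (x - y) <= h (x - y)].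
  by apply: closed_comp (@closed_ge _ (g (x - y))) => h _; exact: weak_star_eval.
rewrite dualBl subr_ge0; apply: (C f) => B /clf[h [Th Bh]]; exists h; split=> //=.
by have := mT _ _ Th _ _ Tg; rewrite dualBl subr_ge0.
Qed.

Lemma maximal_convex T x : maximal_monotone T ->
  convex_set (T x : set (convex_lmodType (dual X))).
Proof.
move=> /maximal_monotoneP[/monotone_operatorP mT maxT] f g l.
rewrite !inE => Tf Tg; apply: maxT => y h Th.
have := mT _ _ Tf _ _ Th; have := mT _ _ Tg _ _ Th.
rewrite !dualBl => gh fh.
change (0 <= ((l%:num *: f + (1 - l%:num) *: g : dual X) (x - y) : R) - h (x - y)).
rewrite dualDl !dualZl.
have : 0 <= l%:num :> R by []. have : l%:num <= 1 :> R by [].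
nra.
Qed.

Lemma maximal_normal_cone T : maximal_monotone T ->
  T = op_add T (normal_cone (dom T)).
Proof.
move=> /maximal_monotoneP[/monotone_operatorP mT maxT].
apply/funext => x; apply/seteqP; split=> [f Tf|_ [f Tf [n [Tx nx] <-]]].
  exists f => //; exists 0; last by rewrite addr0.
  by split=> [|y _]; [exists f|rewrite dual0l].
apply: maxT => y g Tg; have := mT _ _ Tf _ _ Tg; have := nx y (ex_intro _ g Tg).
by rewrite !dualBl dualDl !dualBr; lra.
Qed.

End Conditions.

(** * From maximality along lines to maximality *)

Section LineMaximal.
Context {R : realType} {X : completeNormedModType R}.
Variables (T : operator X) (V : set X) (v0 : X).
Hypotheses (mT : monotone_operator T) (Vcl : closed V) (Vsub : linear_subspace V)
  (TV : forall x, dom T x -> V (x - v0)) (core0 : core_point V (dom T) v0)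
  (maxL : forall v d, core_point V (dom T) v -> V d -> d != 0 -> line_maximal T v d).
Implicit Types (c d v w x y : X) (f g h : dual X).
Local Notation core := (core_point V (dom T)).

Let relT := (monotone_operatorP T).1 mT.

Let TVc x y : dom T x -> dom T y -> V (x - y).
Proof.
move=> /TV Vx /TV Vy;
  have -> : x - y = (x - v0) - (y - v0) by rewrite opprB addrA subrK.
exact: linear_subspaceB.
Qed.

Lemma core_locally_bounded v : core v -> exists delta N : R, 0 < delta /\
  forall y g w, T y g -> `|y - v| <= delta -> V w -> `|w| <= delta -> g w <= N.
Proof.
move=> corev; have [V0 VD VZ] := Vsub.
(* The sublevel sets of [z |-> sup {g (z - y) | g in T y, |y - v| <= 1}], a
   closed convex function which is finite on the domain of [T]. *)
pose F (n : nat) := [set z | forall y g, T y g -> `|y - v| <= 1 -> g (z - y) <= n%:R].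
have Fcl n : closed (F n).
  move=> z clz y g Tg yv.
  have C : closed [set w | g (w - y) <= n%:R].
    apply: closed_comp (@closed_le _ n%:R) => w _.
    apply: (@continuous_comp _ _ _ (fun w => w - y) g); last exact: dual_continuous.
    by apply: cvgB; [exact: cvg_id|exact: cvg_cst].
  by apply: (C z) => B /clz[w [Fw Bw]]; exists w; split=> //; exact: Fw Tg yv.
have domF z : dom T z -> exists n, F n z.
  move=> [h Th]; have [m hm] := dual_bounded h.
  exists (Num.truncn (m%:R * (`|z - v| + 1))).+1 => y g Tg yv.
  apply: le_trans (ltW (truncnS_gt _)).
  have : g (z - y) <= h (z - y) by have := relT Th Tg; rewrite dualBl; lra.
  move=> /le_trans; apply; apply: le_trans (hm _) _; apply: ler_wpM2l => //.
  have -> : z - y = (z - v) - (y - v) by rewrite opprB addrA subrK.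
  by apply: le_trans (ler_normB _ _) _; rewrite lerD2l.
have [w Vw|n [c [r [Vc r0 Fc]]]] := @absorbing_ball _ _ V F v Vcl Vsub Fcl.
  by have [rho rho0 Tw] := corev.2 w Vw; exists rho => // l /Tw/domF.
have [rho rho0 Trho] := corev.2 (- c) ltac:(by rewrite -scaleN1r; exact: VZ).
have [m Fm] := domF _ (Trho rho ltac:(by rewrite ltW// lexx)).
(* With this [q], the point [v + u] is the mean of [v + c + q^-1 *: u], of weight [q], and
   [v - rho *: c], of weight [1 - q]: the multiples of [c] cancel. *)
have [q [q0 q1 qrho]] : exists q, [/\ 0 < q, q <= 1 & (1 - q) * rho = q].
  have rho1 : 0 < 1 + rho by lra.
  exists (rho / (1 + rho)); rewrite divr_gt0//; split=> //.
    by rewrite ler_pdivrMr// mul1r; lra.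
  by field; rewrite gt_eqF.
have F0 u : V u -> `|u| < r * q ->
    forall y g, T y g -> `|y - v| <= 1 -> g (v + u - y) <= n%:R + m%:R.
  move=> Vu ur y g Tg yv.
  have Fn : F n (v + (c + q^-1 *: u)).
    apply: Fc; first by apply: VD => //; exact: VZ.
    by rewrite addrAC subrr add0r normrZ gtr0_norm ?invr_gt0// mulrC ltr_pdivrMr.
  have := ler_wpM2l (_ : 0 <= 1 - q) (Fm _ _ Tg yv).
  have := ler_wpM2l (ltW q0) (Fn _ _ Tg yv).
  rewrite !dualBr !dualDr !dualZr dualNr => Fqn /(_ ltac:(lra)) Fqm.
  have : q * (q^-1 * g u) = g u by rewrite mulrA divff ?gt_eqF// mul1r.
  have : (1 - q) * rho * g c = q * g c by rewrite qrho.
  have : q * n%:R <= n%:R by rewrite ler_piMl.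
  have : (1 - q) * m%:R <= m%:R by rewrite ler_piMl//; lra.
  lra.
pose delta := Num.min 1 (r * q / 3).
have d0 : 0 < delta by rewrite lt_min ltr01 divr_gt0// mulr_gt0.
exists delta, (n%:R + m%:R); split=> // y g w Tg yv Vw wd.
have -> : w = v + (y - v + w) - y.
  by rewrite addrA [v + _]addrC subrK addrAC subrr add0r.
apply: F0 => //; last by apply: le_trans yv _; rewrite ge_min lexx.
  by apply: VD => //; apply: TVc; [exists g|exact: corev.1].
apply: le_lt_trans (ler_normD _ _) _.
have : delta <= r * q / 3 by rewrite ge_min lexx orbT.
have : 0 < r * q by rewrite mulr_gt0.
lra.
Qed.

(** The supremum of the slopes to the left of [t], once finite, is compatible with every slope on
    the line, so maximality along the line places it at [t]. *)
Lemma core_dom_bounded v d t M : core v -> V d -> 0 < t ->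
  (forall u g, u < t -> T (v + u *: d) g -> g d <= M) -> dom T (v + t *: d).
Proof.
move=> corev Vd t0 TM; have [->|d0] := eqVneq d 0.
  by rewrite scaler0 addr0; exact: corev.1.
pose S := [set a | exists u g, [/\ u < t, T (v + u *: d) g & a = g d :> R]].
have S0 : S !=set0.
  by have [g Tg] := corev.1; exists (g d), 0, g; rewrite scale0r addr0.
have SM : ubound S M by move=> _ [u [g [ut Tg ->]]]; exact: TM Tg.
have [|g Tg _] := maxL corev Vd d0 (t := t) (s := sup S); last by exists g.
move=> u g Tg; have [ut|ut|->] := ltgtP u t; last by rewrite subrr mul0r.
  apply: mulr_ge0; rewrite subr_ge0; first exact: ltW.
  by apply: ub_le_sup; [exists M|exists u, g].
apply: mulr_le0; rewrite subr_le0; first exact: ltW.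
apply: ge_sup => // _ [u' [g' [u't Tg' ->]]].
have := relT Tg Tg'; rewrite lineB dualZr dualBl pmulr_rge0 ?subr_ge0 ?subr_gt0//.
exact: lt_trans ut.
Qed.

Lemma core_star v y l : core v -> dom T y -> 0 <= l <= 1 ->
  dom T (v + l *: (y - v)).
Proof.
move=> corev [g Tg] /andP[]; rewrite le_eqVlt => /orP[/eqP <- _|l0].
  by rewrite scale0r addr0; exact: corev.1.
rewrite le_eqVlt => /orP[/eqP ->|l1].
  by rewrite scale1r addrC subrK; exists g.
apply: (@core_dom_bounded _ _ _ (g (y - v))) => //.
  by apply: TVc; [exists g|exact: corev.1].
move=> u h ul Th; have := relT Tg Th.
have -> : y - (v + u *: (y - v)) = (1 - u) *: (y - v).
  by rewrite opprD addrA scalerBl scale1r.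
rewrite dualZr dualBl pmulr_rge0 ?subr_ge0 ?subr_gt0//.
exact: lt_trans l1.
Qed.

(** The slopes along [w] are bounded by local boundedness for [0 <= u < 1], and by the slope at [v]
    for [u < 0]. *)
Lemma core_ball v : core v -> exists2 delta : R, 0 < delta &
  forall w, V w -> `|w| <= delta -> dom T (v + w).
Proof.
move=> corev; have [delta [N [delta0 TN]]] := core_locally_bounded corev.
exists delta => // w Vw wd; rewrite -[w]scale1r.
apply: (@core_dom_bounded _ _ _ N) => // u g u1 Tg.
have [u0|u0] := leP 0 u.
  apply: (TN _ _ _ Tg _ Vw wd); rewrite addrAC subrr add0r normrZ ger0_norm//.
  by apply: le_trans wd; rewrite ler_piMl// ltW.
have [h Th] := corev.1.
have /(TN _ _ w Th) : `|v - v| <= delta by rewrite subrr normr0 ltW.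
move=> /(_ Vw wd); apply: le_trans; have := relT Th Tg.
by rewrite opprD addrA subrr add0r -scaleNr dualZr dualBl pmulr_rge0 ?oppr_gt0// subr_ge0.
Qed.

Lemma ball_core v (delta : R) : 0 < delta ->
  (forall w, V w -> `|w| <= delta -> dom T (v + w)) -> core v.
Proof.
move=> delta0 Tdelta; have [V0 _ VZ] := Vsub; split.
  by rewrite -[v]addr0; apply: Tdelta => //; rewrite normr0 ltW.
move=> w Vw; have w1 : 0 < `|w| + 1 by rewrite ltr_wpDl.
exists (delta / (`|w| + 1)); first exact: divr_gt0.
move=> l /andP[l0]; rewrite ler_pdivlMr// => ld.
apply: Tdelta; first exact: VZ.
by rewrite normrZ ger0_norm//; apply: le_trans ld; rewrite ler_wpM2l// lerDl.
Qed.

Lemma core_open v : core v -> exists2 delta : R, 0 < delta &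
  forall w, V w -> `|w| <= delta -> core (v + w).
Proof.
have [_ VD _] := Vsub; move=> /core_ball[delta delta0 Tdelta].
exists (delta / 2); first exact: divr_gt0.
move=> w Vw wd; apply: (@ball_core _ (delta / 2)); first exact: divr_gt0.
move=> u Vu ud; rewrite -addrA; apply: Tdelta; first exact: VD.
by apply: le_trans (ler_normD _ _) _; lra.
Qed.

(** Moving [v] by [(1 - l)^-1 *: w] inside the core moves the point of parameter [l] towards [y] by
    [w], so [core_star] fills a ball. *)
Lemma core_convex v y l : core v -> dom T y -> 0 <= l < 1 ->
  core (v + l *: (y - v)).
Proof.
move=> corev Ty /andP[l0 l1]; have [_ _ VZ] := Vsub.
have l1' : 0 < 1 - l by rewrite subr_gt0.
have [delta delta0 vdelta] := core_open corev.
apply: (@ball_core _ (delta * (1 - l))); first exact: mulr_gt0.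
move=> w Vw wd.
have ve : core (v + (1 - l)^-1 *: w).
  apply: vdelta; first exact: VZ.
  by rewrite normrZ gtr0_norm ?invr_gt0// mulrC ler_pdivrMr.
have := core_star ve Ty (_ : 0 <= l <= 1).
suff -> : v + (1 - l)^-1 *: w + l *: (y - (v + (1 - l)^-1 *: w)) =
    v + l *: (y - v) + w by apply; rewrite l0 ltW.
rewrite opprD addrA scalerBr addrACA; congr (_ + _).
by rewrite -[X in X - _]scale1r -scalerBl scalerA divff ?scale1r// gt_eqF.
Qed.

Lemma related_line x f v : related T x f -> V (x - v0) -> core v ->
  exists2 g, T x g & g (x - v) = f (x - v).
Proof.
move=> xf Vx corev.
have Vxv : V (x - v).
  have -> : x - v = (x - v0) - (v - v0) by rewrite opprB addrA subrK.
  by apply: linear_subspaceB => //; apply: TV; exact: corev.1.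
have [xv|xv] := eqVneq (x - v) 0.
  have [g Tg] := corev.1; exists g; last by rewrite xv !dual0r.
  by move/eqP: xv; rewrite subr_eq0 => /eqP ->.
have [|g Tg gf] := maxL corev Vxv xv (t := 1) (s := f (x - v)).
  move=> u g /xf; rewrite opprD addrA -{1}[x - v]scale1r -scalerBl.
  by rewrite dualZr dualBl.
by exists g => //; move: Tg; rewrite scale1r addrC subrK.
Qed.

Lemma line_maximal_maximal :
  (forall x, dom T x -> weak_star_closed (T x) /\
     convex_set (T x : set (convex_lmodType (dual X)))) ->
  T = op_add T (normal_cone (dom T)) -> maximal_monotone T.
Proof.
move=> Tclosed TN; have [V0 VD VZ] := Vsub.
have TNx x g (n : dual X) : T x g -> (forall y, dom T y -> n (y - x) <= 0) -> T x (g + n).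
  move=> Tg nx; rewrite TN; exists g => //; exists n => //.
  by split=> //; exists g.
apply/maximal_monotoneP; split=> // x f xf.
(* Otherwise a functional [h] separating [x - v0] from [V] is normal to the domain at [v0], and [c]
   is large enough for [g0 + c *: h] to contradict [xf]. *)
have Vx : V (x - v0).
  apply: contrapT => nVx;
    have [||h hx hV] := @convex_cone_separation _ _ V (x - v0).
  - by split=> // t y _; exact: VZ.
  - by rewrite -((closure_id V).1 Vcl).
  have [g0 Tg0] := core0.1.
  pose c : R := `|(f - g0) (x - v0)| + 1.
  have /xf : T v0 (g0 + c *: h).
    apply: TNx => // y Ty; rewrite dualZl; apply: mulr_ge0_le0.
      by rewrite addr_ge0.
    by apply: hV; exact: TV.
  rewrite opprD addrA dualBl dualZl.
  have := ler_norm ((f - g0) (x - v0)); rewrite -/c.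
  have : 1 <= c by rewrite lerDr.
  have : `|(f - g0) (x - v0)| = c - 1 by rewrite /c addrK.
  nra.
have Tx : dom T x by have [g Tg _] := related_line xf Vx core0; exists g.
have [g0 Tg0] := Tx; have [g1 Tg1] := core0.1.
have [Txcl Txconv] := Tclosed x Tx.
apply: contrapT => nTf.
have [|u uf] := weak_star_separation Txcl _ nTf.
  move=> g h t /andP[t0 t1] Tg Th.
  have := Txconv h g (Itv01 t0 t1); rewrite !inE => /(_ Th Tg).
  by rewrite addrC.
(* The second coordinate is kept at 0, so that [cone_over] gives the plain convex cone generated by
   the core translated by [- x]. *)
pose C z (a : R) := core (x + z) /\ a = 0.
pose P z := cone_over C z 0.
have [P0 PD PZ] : convex_cone P.
  have [||P0 PD PZ] := @cone_rel_over R X C.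
  - by exists (v0 - x), 0; split=> //; rewrite addrC subrK.
  - move=> y z _ _ t /andP[t0 t1] [coreY ->] [coreZ ->]; split; last by lra.
    have -> : x + ((1 - t) *: y + t *: z) = (x + y) + t *: ((x + z) - (x + y)).
      rewrite opprD [(x + z) + _]addrACA subrr add0r scalerBl scale1r scalerBr.
      by rewrite -!addrA [- _ + _]addrC.
    move: t1; rewrite le_eqVlt => /orP[/eqP ->|t1].
      by rewrite scale1r addrC subrK.
    by apply: core_convex => //; [exact: coreZ.1|rewrite t0].
  - split=> // [y z Py Pz|t y t0 Py].
      by have := PD _ _ _ _ Py Pz; rewrite addr0.
    by have := PZ _ _ _ t0 Py; rewrite mulr0.
have Pv v : core v -> P (v - x).
  move=> corev; exists 1, (v - x), 0; rewrite scale1r mulr0; split=> //.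
  by split=> //; rewrite addrC subrK.
have PV z : P z -> V z.
  move=> [k [w [_ [_ [corew _] -> _]]]]; apply: VZ.
  have -> : w = x + w - x by rewrite addrAC subrr add0r.
  by apply: TVc => //; exact: corew.1.
(* Otherwise a functional separating [u] from [P] is normal to the domain, so
   that its multiples can be added to [T x], on which [u] would be unbounded. *)
have clPu : closure P u.
  apply: contrapT => /(convex_cone_separation (And3 P0 PD PZ))[h hu hP].
  have hN y : dom T y -> h (y - x) <= 0.
    move=> Ty.
    have : 0 <= - h (v0 - x) + 1 * (- h (y - v0)).
      apply: (@affine_ge0_right _ _ _ 0) => // l /andP[l0 l1].
      have := hP _ (Pv _ (core_convex core0 Ty (_ : 0 <= l < 1))).
      by rewrite (addrAC v0) dualDr dualZr => /(_ ltac:(by rewrite ltW)); lra.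
    by rewrite !dualBr; lra.
  have := uf _ (TNx x g0 (`|f u - g0 u| *: h) Tg0 _).
  rewrite dualDl dualZl; have := ler_norm (f u - g0 u).
  have : 0 <= `|f u - g0 u| by [].
  move=> n0 n1 /(_ ltac:(by move=> y Ty; rewrite dualZl mulr_ge0_le0// hN)); nra.
have Vu : V u by rewrite ((closure_id V).1 Vcl); exact: (closureS PV) clPu.
have [delta delta0 coredelta] := core_open core0.
(* By monotonicity against [g1], [B] bounds [(g - f) (v0 - x)] for all [g] in [T x]. The choice of
   [l] gives [l * |B| < 1 - l], so the gap of 1 in [uf] cannot be compensated. *)
pose B : R := g1 (v0 - x) - f (v0 - x).
pose l := (2 + `|B|)^-1.
have B2 : 0 < 2 + `|B| by rewrite ltr_wpDr.
have l0 : 0 < l by rewrite invr_gt0.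
have lB : l * (2 + `|B|) = 1 by rewrite mulVf ?gt_eqF.
have [z [Pz zu]] : exists z, P z /\ `|u - z| < l * delta.
  have [z [Pz uz]] := clPu _ (nbhsx_ballx u (l * delta) (mulr_gt0 l0 delta0)).
  by exists z; split=> //; move: uz; rewrite -ball_normE.
have [k [w [b [k0 [corew _] uE _]]]] : P (l *: (v0 - x) + (1 - l) *: u).
  (* The error [u - z] is absorbed by shifting [v0] by [((1 - l) / l) *: (u - z)], of norm at most
     [delta]. *)
  have -> : l *: (v0 - x) + (1 - l) *: u =
      l *: (v0 + ((1 - l) / l) *: (u - z) - x) + (1 - l) *: z.
    rewrite (addrAC v0) [l *: (v0 - x + _)]scalerDr scalerA [l * _]mulrC divfK ?gt_eqF//.
    by rewrite -addrA -scalerDr subrK.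
  have l1 : l <= 1 by have := normr_ge0 B; nra.
  apply: PD; apply: PZ => //; [exact: ltW| |by rewrite subr_ge0].
  apply/Pv/coredelta; first by apply: VZ; apply: linear_subspaceB => //; exact: PV.
  rewrite normrZ ger0_norm ?divr_ge0 ?subr_ge0 ?(ltW l0)//.
  rewrite mulrAC ler_pdivrMr// mulrC [delta * l]mulrC.
  by apply: le_trans (ltW zu); rewrite ler_piMr//; lra.
have [g Tg gw] := related_line xf Vx corew.
have : g (l *: (v0 - x) + (1 - l) *: u) = f (l *: (v0 - x) + (1 - l) *: u).
  rewrite uE !dualZr; congr (_ * _); move: gw.
  by rewrite opprD addrA subrr add0r !dualNr => /oppr_inj.
rewrite !dualDr !dualZr => gf.
have l1 : l <= 1 by have := normr_ge0 B; nra.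
have : l * (g (v0 - x) - f (v0 - x)) <= l * `|B|.
  rewrite ler_wpM2l ?(ltW l0)//; apply: le_trans (ler_norm B).
  by have := relT Tg1 Tg; rewrite dualBl subr_ge0 /B; lra.
have : (1 - l) * 1 <= (1 - l) * (f u - g u).
  by rewrite ler_wpM2l ?subr_ge0//; have := uf _ Tg; lra.
lra.
Qed.

End LineMaximal.

Theorem theorem24 (R : realType) (X : completeNormedModType R)
    (T : operator X) (dimX : dim_gt1 X)
    (T_neq0 : graph T !=set0) (T_monotone : monotone_operator T)
    (domT_not_singleton : ~ exists x : X, dom T = [set x])
    (ic_domT_neq0 : ic (dom T) !=set0) :
  maximal_monotone T <->
  [/\ (forall L : set X, is_line L -> L `<=` aff (dom T) ->
         L `&` ic (dom T) !=set0 ->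
         maximal_monotone (op_add T (normal_cone L))),
      (forall x : X, dom T x ->
         weak_star_closed (T x) /\
         convex_set (T x : set (convex_lmodType (dual X)))) &
      T = op_add T (normal_cone (dom T))].
Proof.
have affT := @affine_aff _ _ (dom T).
have dirP v (corev : ic (dom T) v) : [/\ closed [set w | aff (dom T) (v + w)],
    linear_subspace [set w | aff (dom T) (v + w)],
    forall x, dom T x -> aff (dom T) (v + (x - v)) &
    core_point [set w | aff (dom T) (v + w)] (dom T) v].
  have [clT corev'] := (icP _ _).1 corev; split=> //.
  - apply: closed_comp clT => w _.
    by apply: cvgD; [exact: cvg_cst|exact: cvg_id].
  - by apply: affine_direction => //; apply: sub_aff; exact: corev'.1.
  - by move=> x Tx; rewrite addrC subrK; exact: sub_aff.
split=> [maxT|[maxTL Tclosed TN]].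
  split=> [L lineL Laff [v [Lv corev]]|x _|]; last exact: maximal_normal_cone.
    have [Vcl Vsub TV core] := dirP v corev.
    have [d d0 LE] := lineP lineL Lv; rewrite LE.
    apply/(maximal_add_normal_lineP T_monotone core.1 d0).
    apply: maximal_line_maximal core _ _ d0 => //.
    by apply: Laff; rewrite LE; exists 1; rewrite ?scale1r.
  by split; [exact: maximal_weak_star_closed|exact: maximal_convex].
have [v0 ic0] := ic_domT_neq0; have [Vcl Vsub TV core0] := dirP v0 ic0.
have [_ VD VZ] := Vsub.
apply: (line_maximal_maximal T_monotone Vcl Vsub TV core0) => // v d corev Vd d0.
have Vv : aff (dom T) (v0 + (v - v0)) by apply: TV; exact: corev.1.
apply/(maximal_add_normal_lineP T_monotone corev.1 d0); apply: maxTL.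
- by exists v, d.
- move=> _ [t _ <-]; rewrite -[v](subrKC v0) -addrA.
  by apply: VD => //; exact: VZ.
- exists v; split; first by exists 0; rewrite ?scale0r ?addr0.
  apply/icP; split; first exact: ic0.1.
  split; [exact: corev.1|move=> w /= Vw; apply: corev.2].
  (* The affine hull has the same direction space at [v] as at [v0]. *)
  have -> : w = (v + w - v0) - (v - v0) by rewrite opprB addrA subrK addrAC subrr add0r.
  by apply: (linear_subspaceB Vsub) => //=; rewrite addrC subrK.
Qed.
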